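(* Let $n\ge 1$ be an integer, let $\alpha$ be a real number, and let $A_\alpha=\{z\in\mathbb{C}:\ |z|=1,\ -\alpha\le\arg z\le\alpha\}$. If $\alpha>\frac{n-1}{n}\pi$, then $A_\alpha$ is not $n$-polynomially convex.
   Context: Here $\arg z\in(-\pi,\pi]$ is the principal argument (so $A_\alpha$ is the whole unit circle if $\alpha\ge\pi$). For a compact set $K\subset\mathbb{C}$ and a polynomial $P$ with complex coefficients, $\|P\|_K=\sup_{z\in K}|P(z)|$. For $d\in\mathbb{N}$, the $d$-polynomial hull of $K$ is $\mathcal{P}_d(K)=\{z\in\mathbb{C}:\ |P(z)|\le\|P\|_K\text{ for all polynomials }P\text{ with }\deg P\le d\}$, and $K$ is $d$-polynomially convex if $\mathcal{P}_d(K)=K$. (For $\alpha=\pi$ the set $A_\alpha$ is understood as the full unit circle.) *)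

(* Defs.v *)
From HB Require Import structures.
From mathcomp Require Import all_boot all_order all_algebra.
From mathcomp Require Import complex.
From mathcomp Require Import all_classical all_reals all_analysis.

Set Implicit Arguments.
Unset Strict Implicit.
Unset Printing Implicit Defensive.
Import Order.TTheory GRing.Theory Num.Theory.
Local Open Scope classical_set_scope.
Local Open Scope complex_scope.
Local Open Scope ring_scope.

(* Polar angles of z in (-pi, pi]; the modulus `|z| has type R[i]. *)
Definition polar_angle (R : realType) (z : R[i]) : set R :=
  [set t | - pi < t <= pi /\ z = `|z| * (cos t +i* sin t)].

(* The angle is unique for z != 0 (carg_polar, carg_uniq below); the value at
   z = 0 is arbitrary. *)
Definition carg (R : realType) (z : R[i]) : R := xget 0 (polar_angle z).

(* `|p.[z]| is a nonnegative real element of R[i]; complex.Re brings it to R.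
   For K compact and nonempty, the case of interest, this real-valued supremum
   is the genuine one. *)
Definition poly_norm (R : realType) (K : set R[i]) (p : {poly R[i]}) : R :=
  sup [set complex.Re `|p.[z]| | z in K].

Definition poly_hull (R : realType) (d : nat) (K : set R[i]) : set R[i] :=
  [set z | forall p : {poly R[i]}, (size p <= d.+1)%N ->
             complex.Re `|p.[z]| <= poly_norm K p].

Definition poly_convex (R : realType) (d : nat) (K : set R[i]) : Prop :=
  poly_hull d K = K.

Definition circle_arc (R : realType) (alpha : R) : set R[i] :=
  [set z | `|z| = 1 /\ - alpha <= carg z <= alpha].

Lemma polar_angle_exists (R : realType) (z : R[i]) :
  z != 0 -> polar_angle z !=set0.
Proof.
case: z => a b; rewrite eq_complex /= => nz.
have s_gt0 : 0 < a ^+ 2 + b ^+ 2.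
  rewrite lt_neqAle addr_ge0 ?sqr_ge0 // andbT eq_sym.
  by rewrite paddr_eq0 ?sqr_ge0 // !sqrf_eq0.
rewrite /polar_angle normc_def /=.
set s := a ^+ 2 + b ^+ 2 in s_gt0 *; set r := Num.sqrt s.
have r_gt0 : 0 < r by rewrite sqrtr_gt0.
have r_neq0 : r != 0 by rewrite gt_eqF.
have ab1 : (a / r) ^+ 2 + (b / r) ^+ 2 = 1.
  by rewrite !expr_div_n -mulrDl sqr_sqrtr ?ltW // divff // gt_eqF.
have ar1 : -1 <= a / r <= 1.
  rewrite -ler_norml -(@expr_le1 _ 2) // -normrX ger0_norm ?sqr_ge0 //.
  by rewrite -ab1 lerDl sqr_ge0.
have sinE : sin (acos (a / r)) = `|b / r|.
  by rewrite sin_acos // -sqrtr_sqr -ab1 addrAC subrr add0r.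
have cosE : cos (acos (a / r)) = a / r by rewrite acosK.
have polarE : a +i* b = r%:C * (a / r +i* (b / r)).
  by simpc; rewrite ![r * _]mulrC !divfK.
have [b_ge0|b_lt0] := leP 0 b.
  exists (acos (a / r)); split.
    by rewrite acos_lepi // (lt_le_trans _ (acos_ge0 ar1)) // oppr_lt0 pi_gt0.
  rewrite cosE sinE ger0_norm; first exact: polarE.
  by rewrite divr_ge0 // ltW.
exists (- acos (a / r)); split.
  have acos_le0 : - acos (a / r) <= 0 by rewrite oppr_le0 acos_ge0.
  rewrite ltrN2 (le_trans acos_le0 (pi_ge0 R)) andbT.
  have /andP[ar_geN1 ar_le1] := ar1.
  apply: acos_ltpi; rewrite ar_le1 andbT lt_neqAle ar_geN1 andbT.
  apply/eqP => arE; move/eqP: ab1; rewrite -arE sqrrN expr1n -subr_eq0.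
  rewrite addrAC subrr add0r sqrf_eq0 mulf_eq0 invr_eq0 (negPf r_neq0) orbF.
  by rewrite lt_eqF.
rewrite cosN sinN cosE sinE ltr0_norm; first by rewrite opprK; exact: polarE.
by rewrite pmulr_llt0 ?invr_gt0.
Qed.

Lemma carg_polar (R : realType) (z : R[i]) :
  z != 0 -> polar_angle z (carg z).
Proof. by move=> /polar_angle_exists[t zt]; exact: xgetPex (ex_intro _ t zt). Qed.

Lemma carg_uniq (R : realType) (z : R[i]) (t : R) :
  z != 0 -> polar_angle z t -> carg z = t.
Proof.
move=> nz; have := carg_polar nz; move: (carg z) => u [uB zu] [tB zt].
have [cosE sinE] : cos u = cos t /\ sin u = sin t.
  have /(mulfI _) : `|z| * (cos u +i* sin u) = `|z| * (cos t +i* sin t).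
    by rewrite -zu -zt.
  by rewrite normr_eq0 => /(_ nz)[].
wlog tu : t u {zt zu} uB tB cosE sinE / t <= u.
  move=> W; have [tu|/ltW ut] := leP t u; first exact: W.
  by apply/esym/W.
have [t_ge0|t_lt0] := leP 0 t.
  apply: cos_inj => //; rewrite in_itv /=.
    by rewrite (le_trans t_ge0 tu); case/andP: uB.
  by rewrite t_ge0; case/andP: tB.
case/andP: uB => uN up; case/andP: tB => tN tp.
have [u_ge0|u_lt0] := leP 0 u.
  have : 0 <= sin u by rewrite sin_ge0_pi // u_ge0.
  rewrite sinE leNgt -oppr_gt0 -sinN sin_gt0_pi //.
  by rewrite oppr_gt0 t_lt0 /= ltrNl.
apply: oppr_inj; apply: cos_inj; rewrite ?in_itv /= ?cosN //.
  by rewrite oppr_ge0 ltW //= lerNl ltW.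
by rewrite oppr_ge0 ltW //= lerNl ltW.
Qed.

(* Main.v *)
(* For `|a| < 1 and `|tau| = 1 the n + 1 roots z_j of the para-orthogonal
   polynomial z^n (z - a) + tau (1 - a^* z) are simple and lie on the unit
   circle, and the Lagrange weights expressing p.[a] through the p.[z_j], for
   p of degree at most n, are positive with sum 1.  Hence a belongs to the
   degree n hull of any set containing all the z_j.  For tau = (-1)^(n-1) and
   a real a -> 1, the roots tend to 1 and to the n-th roots of (-1)^(n-1),
   whose largest gap centered at -1 is |arg| > (n-1)/n pi; so for a close to 1
   all the roots fall in the arc, whereas a itself is not on the circle. *)
Require Import Defs.
From mathcomp Require Import all_boot all_order all_algebra.
From mathcomp Require Import complex.
From mathcomp Require Import all_classical all_reals all_analysis.
From mathcomp Require Import ring lra.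
Import Order.TTheory GRing.Theory Num.Theory.
Local Open Scope ring_scope.

(** * Lagrange interpolation and simplicity of roots *)

Lemma lagrange_prod_XsubC (F : fieldType) (rs : seq F) (p : {poly F}) :
    uniq rs -> (size p <= size rs)%N ->
    let q := \prod_(z <- rs) ('X - z%:P) in
  p = \sum_(z <- rs) (p.[z] / q^`().[z]) *: \prod_(y <- rem z rs) ('X - y%:P).
Proof.
move=> rsU sp q; apply/eqP; rewrite -subr_eq0; apply/eqP.
(* In the product rule at [z], the term that keeps the factor ['X - z%:P] vanishes. *)
have dq z : z \in rs -> q^`().[z] = (\prod_(y <- rem z rs) ('X - y%:P)).[z].
  move=> zrs; rewrite /q (big_rem z)//= derivM derivXsubC mul1r hornerD hornerM.
  by rewrite hornerXsubC subrr mul0r addr0.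
(* The difference of the two sides has size at most [size rs] and vanishes at every node, so it is
   zero. *)
apply: (@roots_geq_poly_eq0 _ _ rs) => //.
- apply/allP => x xrs; rewrite rootE hornerD hornerN horner_sum.
  rewrite (big_rem x) //= hornerZ dq // divfK; last first.
    by rewrite -[_ == 0]/(root _ _) root_prod_XsubC mem_rem_uniq // !inE eqxx.
  rewrite big_seq big1 ?addr0 ?subrr // => z.
  rewrite mem_rem_uniq // inE => /andP[zx zrs]; rewrite hornerZ.
  suff /rootP-> : root (\prod_(y <- rem z rs) ('X - y%:P)) x by rewrite mulr0.
  by rewrite root_prod_XsubC mem_rem_uniq // !inE eq_sym zx.
- rewrite (leq_trans (size_polyD _ _)) // geq_max sp size_polyN.
  apply: (leq_trans (size_sum _ _ _)).
  rewrite big_seq; elim/big_rec : _ => // z m zrs mrs.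
  rewrite geq_max mrs andbT (leq_trans (size_scale_leq _ _)) //.
  rewrite size_prod_XsubC size_rem // prednK //.
  by case: (rs) zrs.
Qed.

(** A repeated entry [z] remains a root of the cofactor of ['X - z%:P], so the derivative vanishes
    at [z] as well. *)
Lemma uniq_simple_roots (F : fieldType) (rs : seq F) :
    (forall z, z \in rs -> (\prod_(y <- rs) ('X - y%:P))^`().[z] != 0) ->
  uniq rs.
Proof.
move=> dq; apply: count_mem_uniq => z.
have [zrs|/count_memPn//] := boolP (z \in rs).
rewrite (permP (perm_to_rem zrs)) /= eqxx.
suff /count_memPn-> : z \notin rem z rs by [].
rewrite -root_prod_XsubC; apply: contra (dq _ zrs) => /rootP zr.
rewrite (big_rem z)//= derivM derivXsubC mul1r hornerD hornerM.
by rewrite hornerXsubC subrr mul0r addr0 zr.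
Qed.

(** * Positive quadrature at the roots of the para-orthogonal polynomial *)

Section Quadrature.
Variables (C : numClosedFieldType) (n : nat) (a tau : C).
Hypotheses (a1 : `|a| < 1) (tau1 : `|tau| = 1).

(** The degree bound called n above is [n.+1] in this section, so there are [n.+2] roots. *)
Definition paraorth : {poly C} :=
  'X^(n.+1) * ('X - a%:P) + tau *: (1 - a^* *: 'X).

Lemma horner_paraorth z :
  paraorth.[z] = z ^+ n.+1 * (z - a) + tau * (1 - a^* * z).
Proof. by rewrite /paraorth !hornerE. Qed.

Lemma size_paraorth_main : size ('X^(n.+1) * ('X - a%:P) : {poly C}) = n.+3.
Proof.
by rewrite size_monicM ?monicXn ?polyXsubC_eq0 // size_polyXn size_XsubC addn2.
Qed.

Lemma size_paraorth_tail :
  (size (tau *: (1 - a^* *: 'X)) <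
   size ('X^(n.+1) * ('X - a%:P) : {poly C})%R)%N.
Proof.
rewrite size_paraorth_main ltnS (leq_trans (size_scale_leq _ _)) //.
rewrite (leq_trans (size_polyD _ _)) // geq_max size_poly1 size_polyN /=.
by rewrite (leq_trans (size_scale_leq _ _)) // size_polyX.
Qed.

Lemma paraorth_monic : paraorth \is monic.
Proof.
rewrite monicE lead_coefDl ?size_paraorth_tail // -monicE.
by rewrite monicMl ?monicXn ?monicXsubC.
Qed.

Lemma size_paraorth : size paraorth = n.+3.
Proof. by rewrite size_polyDl ?size_paraorth_tail ?size_paraorth_main. Qed.

(** At a root, |z|^(n+1) |z - a| = |1 - a^* z|. The identity [D] makes |1 - a^* z| larger than |z -
    a| inside the disc and smaller outside, while the power of |z| pulls the other way. *)
Lemma paraorth_root_norm z : root paraorth z -> `|z| = 1.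
Proof.
rewrite rootE horner_paraorth addr_eq0 => /eqP/(congr1 Num.norm).
rewrite normrN !normrM tau1 mul1r normrX => zE.
have D : `|1 - a^* * z| ^+ 2 - `|z - a| ^+ 2 =
    (1 - `|z| ^+ 2) * (1 - `|a| ^+ 2).
  by rewrite !normCK !rmorphB !rmorphM /= rmorph1 conjCK; ring.
have a2 : 0 < 1 - `|a| ^+ 2 by rewrite subr_gt0 expr_lt1.
have z0 : 0 <= `|z| by [].
have [z1|z1|//] := real_ltgtP (normr_real z) (@real1 _).
- have : 0 < `|1 - a^* * z| ^+ 2 - `|z - a| ^+ 2.
    by rewrite D mulr_gt0 // subr_gt0 expr_lt1.
  rewrite subr_gt0 ltr_pXn2r ?nnegrE // -zE => /lt_geF/negbT/negP[].
  by rewrite ler_piMl // exprn_ile1 // ltW.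
- have : `|1 - a^* * z| ^+ 2 - `|z - a| ^+ 2 < 0.
    by rewrite D pmulr_llt0 // subr_lt0 expr_gt1.
  rewrite subr_lt0 ltr_pXn2r ?nnegrE // -zE => /lt_geF/negbT/negP[].
  by rewrite ler_peMl // exprn_ege1 // ltW.
Qed.

(** The right side is nonzero, which gives both z != a and the simplicity of the root; up to the
    factor [- tau] it is the denominator of the quadrature weight. *)
Lemma deriv_paraorth_root z : root paraorth z ->
  (z - a) * paraorth^`().[z] =
    - (tau * (n.+1%:R * `|z - a| ^+ 2 + (1 - `|a| ^+ 2))).
Proof.
move=> zr; have z1 := paraorth_root_norm _ zr.
have z0 : z != 0 by rewrite -normr_gt0 z1.
have zz : z * z^* = 1 by rewrite -normCK z1 expr1n.
move: zr; rewrite rootE horner_paraorth addr_eq0 => /eqP zE.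
(* The extra factor z raises z^n to z^(n+1), which the root equation eliminates. *)
apply: (mulfI z0); rewrite !normCK rmorphB /=.
have -> : paraorth^`().[z] =
    n.+1%:R * z ^+ n * (z - a) + z ^+ n.+1 - tau * a^*.
  rewrite /paraorth derivD derivM derivXn derivXsubC derivZ derivB derivZ.
  rewrite derivX -[1]/(1%:P) derivC hornerD hornerZ hornerD hornerM.
  rewrite hornerMn hornerXn.
  by rewrite -mulr_natl !hornerE /=; ring.
transitivity (n.+1%:R * (z ^+ n.+1 * (z - a)) * (z - a)
    + z * (z ^+ n.+1 * (z - a)) - tau * a^* * z * (z - a)).
  by rewrite exprS; ring.
(* Writing 1 as z z^* turns 1 - a^* z into z (z - a)^*, whence the term |z - a|^2. *)
rewrite zE; transitivity (- (tau * (n.+1%:R * (z - a) * (z * z^* - a^* * z)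
    + z * (1 - a * a^*)))); last by ring.
by rewrite zz; ring.
Qed.

Lemma norm_horner_paraorth_roots (p : {poly C}) (M : C) :
    (size p <= n.+2)%N ->
    (forall z, `|z| = 1 -> root paraorth z -> `|p.[z]| <= M) ->
  `|p.[a]| <= M.
Proof.
have [rs] := closed_field_poly_normal paraorth.
rewrite (monicP paraorth_monic) scale1r => qE sp pM.
have rsE z : (z \in rs) = root paraorth z by rewrite qE root_prod_XsubC.
have wpos z : 0 < n.+1%:R * `|z - a| ^+ 2 + (1 - `|a| ^+ 2).
  by rewrite ltr_wpDl ?subr_gt0 ?expr_lt1 // mulr_ge0 // exprn_ge0.
have tau0 : tau != 0 by rewrite -normr_gt0 tau1.
have dq z : z \in rs -> (z - a) * paraorth^`().[z] != 0.
  rewrite rsE => /deriv_paraorth_root->.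
  by rewrite oppr_eq0 mulf_neq0 // gt_eqF.
have rsU : uniq rs.
  apply: uniq_simple_roots => z /dq; rewrite -qE mulf_eq0 negb_or.
  by case/andP.
have srs : size rs = n.+2.
  by have := size_paraorth; rewrite qE size_prod_XsubC => -[].
(* This is q(a) / ((a - z) q'(z)) for q = [paraorth]: q(a) = tau (1 - |a|^2), and tau cancels
   against the derivative formula. *)
pose w z := (1 - `|a| ^+ 2) / (n.+1%:R * `|z - a| ^+ 2 + (1 - `|a| ^+ 2)).
have quad (f : {poly C}) : (size f <= n.+2)%N ->
    f.[a] = \sum_(z <- rs) f.[z] * w z.
  move=> sf; rewrite {1}(@lagrange_prod_XsubC _ rs f) ?srs // -qE horner_sum.
  apply: eq_big_seq => z zrs; rewrite hornerZ -mulrA; congr (_ * _).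
  have := dq _ zrs; rewrite mulf_eq0 negb_or => /andP[za dz].
  have az : a - z != 0 by rewrite -opprB oppr_eq0.
  have -> : (\prod_(y <- rem z rs) ('X - y%:P)).[a] =
      tau * (1 - `|a| ^+ 2) / (a - z).
    have -> : tau * (1 - `|a| ^+ 2) = paraorth.[a].
      by rewrite horner_paraorth subrr mulr0 add0r normCKC.
    rewrite qE [in RHS](big_rem z) //= hornerM hornerXsubC.
    by rewrite mulrAC mulfV ?mul1r.
  have dE := deriv_paraorth_root; rewrite rsE in zrs; have {}dE := dE _ zrs.
  rewrite /w; have := wpos z; move: (n.+1%:R * _ + _) dE => D dE D0.
  have {dE} -> : paraorth^`().[z] = - (tau * D) / (z - a).
    by rewrite -dE mulrAC mulfV // mul1r.
  by field; rewrite tau0 za az gt_eqF.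
have w_ge0 z : 0 <= w z by rewrite divr_ge0 // ltW // subr_gt0 expr_lt1.
have w1 : \sum_(z <- rs) w z = 1.
  have := @quad 1; rewrite size_poly1 hornerC => /(_ isT) ->.
  by apply: eq_bigr => z _; rewrite hornerC mul1r.
rewrite quad // (le_trans (ler_norm_sum _ _ _)) // -[M]mulr1 -w1 mulr_sumr.
rewrite big_seq [leRHS]big_seq ler_sum // => z zrs.
rewrite normrM (ger0_norm (w_ge0 z)) ler_wpM2r // pM -?rsE //.
by apply: paraorth_root_norm; rewrite -rsE.
Qed.
End Quadrature.

(** * Trigonometric form of the root equation *)

Section Cis.
Local Open Scope complex_scope.
Variable R : realType.

Definition cis (x : R) : R[i] := cos x +i* sin x.

Lemma cisD x y : cis (x + y) = cis x * cis y.
Proof.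
rewrite /cis cosD sinD; simpc.
by rewrite (mulrC (cos x) (sin y)) (addrC (sin x * _)).
Qed.

Lemma cis_exp x k : cis x ^+ k = cis (x *+ k).
Proof.
elim: k => [|k IH]; first by rewrite mulr0n /cis cos0 sin0.
by rewrite exprS IH mulrS cisD.
Qed.

Lemma cisDpi x : cis (x + pi) = - cis x.
Proof. by rewrite /cis cosDpi sinDpi; simpc. Qed.

Lemma cisBpi x : cis (x - pi) = - cis x.
Proof. by apply: oppr_inj; rewrite opprK -cisDpi subrK. Qed.

(* Factoring out [cis ((m + 1) x / 2)] leaves a real trigonometric sum. *)
Lemma reciprocal_cis_eq0 (m : nat) (r x : R) :
    cis x ^+ m * (cis x + r%:C) + (1 + r%:C * cis x) = 0 ->
  cos (m.+1%:R * x / 2) + r * cos ((m%:R - 1) * x / 2) = 0.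
Proof.
move=> /(congr1 (fun z => z * cis (- (m.+1%:R * x / 2)))).
rewrite mul0r cis_exp.
set u := m.+1%:R * x / 2; set v := (m%:R - 1) * x / 2.
have e1 : cis (x *+ m) * cis x * cis (- u) = cis u.
  by rewrite -!cisD /u -mulr_natl -natr1; congr cis; field.
have e2 : cis (x *+ m) * cis (- u) = cis v.
  by rewrite -!cisD /u /v -mulr_natl -natr1; congr cis; field.
have e3 : cis x * cis (- u) = cis (- v).
  by rewrite -!cisD /u /v -natr1; congr cis; field.
have -> : (cis (x *+ m) * (cis x + r%:C) + (1 + r%:C * cis x)) * cis (- u)
    = cis (x *+ m) * cis x * cis (- u) + cis (- u)
    + r%:C * (cis (x *+ m) * cis (- u) + cis x * cis (- u)) by ring.
rewrite e1 e2 e3 /cis !cosN; simpc => -[+ _]; lra.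
Qed.

(** By the product formula the sum equals 2 A B - c V, with A = cos (m x / 2), B = cos (x / 2) and V
    = cos ((m - 1) x / 2). Since A B >= c, with equality at x = d, and V <= 1, it is at least c. *)
Lemma half_angle_sum_gt0 (m : nat) (d x : R) :
    (0 < m)%N -> 0 <= d -> m%:R * d < pi -> `|x| <= d ->
  let c := cos (m%:R * d / 2) * cos (d / 2) in
  0 < c <= 1 /\ 0 < cos (m.+1%:R * x / 2) + (1 - c) * cos ((m%:R - 1) * x / 2).
Proof.
move=> m0 d0 md xd c.
have m1 : 1 <= m%:R :> R by rewrite ler1n.
have dmd : d <= m%:R * d by rewrite ler_peMl.
have pi0 := pi_gt0 R.
have cosx (k : R) : 0 <= k -> k * d < pi -> cos (k * d / 2) <= cos (k * x / 2).
  move=> k0 kd; have -> : cos (k * x / 2) = cos (k * `|x| / 2).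
    by case: (ger0P x) => // _; rewrite mulrN mulNr cosN.
  have kx : k * `|x| <= k * d by rewrite ler_wpM2l.
  have kx0 : 0 <= k * `|x| by rewrite mulr_ge0.
  rewrite leNgt ltr_cos ?in_itv /=; first by rewrite -leNgt ler_pM2r ?invr_gt0.
    by apply/andP; split; lra.
  by apply/andP; split; lra.
have cos0 (k : R) : 0 <= k -> k * d < pi -> 0 < cos (k * d / 2).
  move=> k0 kd; have kd0 : 0 <= k * d by rewrite mulr_ge0.
  by apply: cos_gt0_pihalf; apply/andP; split; lra.
have A0 := cos0 _ (ler0n _ m) md; have A1 := cosx _ (ler0n _ m) md.
have B0 : 0 < cos (d / 2) by rewrite -[d]mul1r cos0 //; lra.
have B1 : cos (d / 2) <= cos (x / 2).
  by rewrite -[d]mul1r -[x]mul1r cosx //; lra.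
have cc : 0 < c <= 1 by rewrite mulr_gt0 //= mulr_ile1 ?cos_le1 // ltW.
split=> //; case/andP: cc => c0 c1.
have -> : cos (m.+1%:R * x / 2) = 2 * (cos (m%:R * x / 2) * cos (x / 2))
    - cos ((m%:R - 1) * x / 2).
  have -> : m.+1%:R * x / 2 = m%:R * x / 2 + x / 2 by rewrite -natr1; field.
  have -> : (m%:R - 1) * x / 2 = m%:R * x / 2 - x / 2 by field.
  by rewrite cosB cosD; ring.
have : c <= cos (m%:R * x / 2) * cos (x / 2) by rewrite ler_pM // ltW.
have := cos_le1 ((m%:R - 1) * x / 2); nra.
Qed.
End Cis.

Arguments cis {R}.

(** * Locating the roots on the arc *)

Section CircleArc.
Local Open Scope complex_scope.
Variables (R : realType) (m : nat) (alpha : R).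

Lemma normr_complexE (z : R[i]) : `|z| = (complex.Re `|z|)%:C.
Proof. by rewrite normc_def. Qed.

(** Angles are measured from -1, the centre of the gap, of half-width [pi - alpha] when 0 <= alpha
    <= pi. The maximum keeps the bound nonnegative for larger [alpha], where no point of the circle
    is left out. *)
Lemma notin_circle_arc (z : R[i]) : `|z| = 1 -> ~ circle_arc alpha z ->
  exists2 x, z = - cis x & `|x| <= Num.max 0 (pi - alpha).
Proof.
move=> z1 zA; have z0 : z != 0 by rewrite -normr_gt0 z1.
have [tB] := carg_polar z0; rewrite z1 mul1r -/(cis (carg z)) => zE.
have tA : ~~ (- alpha <= carg z <= alpha) by apply/negP => tA; apply: zA.
case/andP: tB => t1 t2; rewrite zE {zA}.
move: (carg z) tA t1 t2 => t tA t1 t2; rewrite {z0 z1 zE}.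
have [ta|ta] := ltP t (- alpha).
  exists (t + pi); first by rewrite cisDpi opprK.
  by rewrite le_max ger0_norm; [apply/orP; right; lra | lra].
exists (t - pi); first by rewrite cisBpi opprK.
move: tA; rewrite ta -ltNge => tA.
by rewrite le_max ler0_norm; [apply/orP; right; lra | lra].
Qed.

Lemma paraorth_roots_circle_arc : (m.+1%:R - 1) / m.+1%:R * pi < alpha ->
  exists2 r : R, 0 <= r < 1 &
    forall z, `|z| = 1 -> root (paraorth R[i] m r%:C ((-1) ^+ m)) z ->
      circle_arc alpha z.
Proof.
move=> alpha_gt; set d := Num.max 0 (pi - alpha).
have d0 : 0 <= d by rewrite le_max lexx.
(* The hypothesis on [alpha] amounts to (m + 1) (pi - alpha) < pi. *)
have dpi : m.+1%:R * d < pi.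
  rewrite /d maxr_pMr ?ler0n // mulr0 gt_max pi_gt0 /=.
  have m0 : 0 < m.+1%:R :> R by rewrite ltr0n.
  move: alpha_gt; rewrite mulrAC ltr_pdivrMr //; lra.
have key x : `|x| <= d -> _ := @half_angle_sum_gt0 R m.+1 d x isT d0 dpi.
set c := cos (m.+1%:R * d / 2) * cos (d / 2) in key.
have /andP[c0 c1] : 0 < c <= 1 by have [] := key 0; rewrite ?normr0.
(* An explicit value of a replaces the limit a -> 1. *)
exists (1 - c); first by apply/andP; split; lra.
move=> z z1 zr; apply: contrapT => /(notin_circle_arc _ z1)[x zx /key[_]].
suff -> : cos (m.+2%:R * x / 2) + (1 - c) * cos ((m.+1%:R - 1) * x / 2) = 0.
  by rewrite ltxx.
apply: reciprocal_cis_eq0; move: zr; rewrite rootE horner_paraorth zx.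
rewrite conj_Creal; last by rewrite complex_real.
(* At z = - cis x both terms carry the sign (-1)^m, thanks to the choice of tau; cancelling it
   leaves the equation of [reciprocal_cis_eq0]. *)
rewrite [(- cis x) ^+ _]exprNn [(-1) ^+ m.+1]exprS mulN1r.
set w := cis x; set r := _%:C => /eqP zr.
have := signr_eq0 R[i] m; move: ((-1) ^+ m) zr => s zr /negbT s0.
by apply: (mulfI s0); rewrite mulr0 -[RHS]zr; ring.
Qed.

(** A real [sup] dominates its set only if the set is bounded above; on the unit circle the sum of
    the moduli of the coefficients is a bound. *)
Lemma poly_norm_circle_arc_ub (p : {poly R[i]}) (z : R[i]) :
  circle_arc alpha z -> complex.Re `|p.[z]| <= poly_norm (circle_arc alpha) p.
Proof.
move=> zA; apply: ub_le_sup; last by exists z.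
exists (complex.Re (\sum_(i < size p) `|p`_i|)) => _ [y [y1 _] <-].
suff : `|p.[y]| <= \sum_(i < size p) `|p`_i| by rewrite lecE => /andP[].
rewrite horner_coef (le_trans (ler_norm_sum _ _ _)) // ler_sum // => i _.
by rewrite normrM normrX y1 expr1n mulr1.
Qed.
End CircleArc.

Theorem proposition16 (R : realType) (n : nat) (alpha : R) :
  (1 <= n)%N -> (n%:R - 1) / n%:R * pi < alpha -> ~ poly_convex n (circle_arc alpha).
Proof.
case: n => // m _ /paraorth_roots_circle_arc[r /andP[r0 r1] roots] hullE.
have r_norm : `|real_complex R r| = real_complex R r.
  by rewrite ger0_norm // ler0c.
(* Convexity would put r, a hull point of modulus less than 1, on the arc. *)
have : circle_arc alpha (real_complex R r).
  rewrite -hullE => p sp; rewrite -lecR -normr_complexE.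
  apply: (@norm_horner_paraorth_roots _ m _ ((-1) ^+ m)) => //.
  - by rewrite r_norm (ltcR r 1).
  - by rewrite normrX normrN1 expr1n.
  - move=> z z1 zr; rewrite normr_complexE lecR.
    exact: poly_norm_circle_arc_ub (roots _ z1 zr).
by case; rewrite r_norm => -[r1E]; rewrite r1E ltxx in r1.
Qed.
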